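(* Let $(\Phi,\Phi_0)$ be a morphism of Lie groupoids from $G\rightrightarrows M$ to $G'\rightrightarrows M'$, let $L:G\to\mathbb R$ and $L':G'\to\mathbb R$ be discrete Lagrangians with $L=L'\circ\Phi$, and suppose that $(g,h)\in G_2$. (i) If $(\Phi(g),\Phi(h))$ is a solution of the discrete Euler–Lagrange equations for $L'$, then $(g,h)$ is a solution of the discrete Euler–Lagrange equations for $L$. (ii) If $\Phi$ is a submersion, then $(g,h)$ is a solution of the discrete Euler–Lagrange equations for $L$ if and only if $(\Phi(g),\Phi(h))$ is a solution of the discrete Euler–Lagrange equations for $L'$. (iii) If $\Phi$ is an immersion, then $(g,h)$ is a solution of the discrete Euler–Lagrange equations for $L$ if and only if $D_{\mathrm{DEL}}L'(\Phi(g),\Phi(h))$ vanishes on $\operatorname{Im}(A_{\beta(g)}\Phi)$.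
   Context: A Lie groupoid $G\rightrightarrows M$ has source $\alpha$ and target $\beta$ (surjective submersions $G\to M$), identity section $\epsilon:M\to G$, inversion $i(g)=g^{-1}$, and a product $gh$ defined for $(g,h)\in G_2=\{(g,h):\beta(g)=\alpha(h)\}$, with $\alpha(gh)=\alpha(g)$, $\beta(gh)=\beta(h)$. Translations: $l_g:\alpha^{-1}(\beta(g))\to\alpha^{-1}(\alpha(g))$, $h\mapsto gh$, and $r_g:\beta^{-1}(\alpha(g))\to\beta^{-1}(\beta(g))$, $h\mapsto hg$. The Lie algebroid $AG\to M$ has fibre $A_xG=\ker T_{\epsilon(x)}\alpha$; $A^*G$ is its dual bundle. A discrete Lagrangian is a smooth function $L:G\to\mathbb R$. The discrete Euler–Lagrange operator $D_{\mathrm{DEL}}L:G_2\to A^*G$ is, for $v\in A_{\beta(g)}G$, $D_{\mathrm{DEL}}L(g,h)(v)=v\bigl(L\circ l_g+L\circ r_h\circ i\bigr)$, where the function $L\circ l_g+L\circ r_h\circ i$ is defined on $\alpha^{-1}(\beta(g))$ and $v$ is a tangent vector to it at $\epsilon(\beta(g))$. A pair $(g,h)\in G_2$ is a solution of the discrete Euler–Lagrange equations for $L$ if $D_{\mathrm{DEL}}L(g,h)=0$. A Lie groupoid morphism is a smooth map $\Phi:G\to G'$ sending composable pairs to composable pairs with $\Phi(gh)=\Phi(g)\Phi(h)$; it induces a smooth base map $\Phi_0:M\to M'$. $A_x\Phi:A_xG\to A_{\Phi_0(x)}G'$ is the restriction of $T_{\epsilon(x)}\Phi$. *)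

(* Defs.v *)
From mathcomp Require Import all_boot all_order all_algebra.
From mathcomp Require Import all_classical all_reals all_analysis.

Set Implicit Arguments.
Unset Strict Implicit.
Unset Printing Implicit Defensive.

Import Order.TTheory GRing.Theory Num.Theory.
Import numFieldNormedType.Exports.
Local Open Scope classical_set_scope.
Local Open Scope ring_scope.

(* C^k on an open set U.  The recursion on directional derivatives is the usual
   notion for finite-dimensional V, the only case used below.  Only the values
   of f on U matter. *)
Fixpoint Ck_on (R : realType) (V W : normedModType R) (k : nat)
    (U : set V) (f : V -> W) : Prop :=
  match k with
  | 0 => forall x, U x -> {for x, continuous f}
  | k'.+1 => (forall x, U x -> differentiable f x) /\
             (forall v : V, Ck_on k' U ('D_v f))
  end.

Definition smooth_on (R : realType) (V W : normedModType R)
    (U : set V) (f : V -> W) : Prop :=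
  forall k, Ck_on k U f.

(* Smoothness on an arbitrary subset D: local smooth extensions exist.  When D
   is an embedded submanifold this is smoothness for its manifold structure. *)
Definition is_extension_at (R : realType) (V W : normedModType R)
    (D : set V) (f : V -> W) (x : V) (F : V -> W) : Prop :=
  exists U : set V, [/\ open U, U x, smooth_on U F &
    forall y, U y -> D y -> F y = f y].

Definition smooth_along (R : realType) (V W : normedModType R)
    (D : set V) (f : V -> W) : Prop :=
  forall x, D x -> exists F : V -> W, is_extension_at D f x F.

(* A homeomorphism between open sets of T and R^n; [cmap] and [cinv] are
   irrelevant outside [cdom] and [ccod]. *)
Record chart (R : realType) (T : topologicalType) (n : nat) := Chart {
  cdom : set T;
  ccod : set 'rV[R]_n;
  cmap : T -> 'rV[R]_n;
  cinv : 'rV[R]_n -> T;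
  cdom_open : open cdom;
  ccod_open : open ccod;
  cmap_cod : forall p, cdom p -> ccod (cmap p);
  cinv_dom : forall y, ccod y -> cdom (cinv y);
  cmapK : forall p, cdom p -> cinv (cmap p) = p;
  cinvK : forall y, ccod y -> cmap (cinv y) = y;
  cmap_cont : {within cdom, continuous cmap};
  cinv_cont : {within ccod, continuous cinv}
}.

(* Smooth manifolds: Hausdorff, second countable, pure dimension [dim].  Any
   smooth atlas is allowed, not only a maximal one. *)
Record manifold (R : realType) := Manifold {
  carrier :> topologicalType;
  dim : nat;
  atlas : set (chart R carrier dim);
  manifold_hausdorff : hausdorff_space carrier;
  manifold_second_countable : @second_countable carrier;
  atlas_cover : forall p : carrier, exists c, atlas c /\ cdom c p;
  atlas_compat : forall c d, atlas c -> atlas d ->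
    smooth_on (ccod c `&` cinv c @^-1` cdom d) (cmap d \o cinv c)
}.

(* A preferred chart around each point.  The tangent space T_p M is R^(dim M),
   a tangent vector being identified with its components in [chart_at p]. *)
Definition chart_at (R : realType) (M : manifold R) (p : M) :
    chart R M (dim M) :=
  projT1 (cid (atlas_cover p)).

Definition smooth_map (R : realType) (M N : manifold R) (f : M -> N) : Prop :=
  continuous f /\
  forall c d, atlas c -> atlas d ->
    smooth_on (ccod c `&` (f \o cinv c) @^-1` cdom d)
              (cmap d \o f \o cinv c).

Definition smooth_fun (R : realType) (M : manifold R) (f : M -> R) : Prop :=
  forall c, atlas c -> smooth_on (ccod c) (f \o cinv c : _ -> R^o).

Definition tangent_map (R : realType) (M N : manifold R) (f : M -> N) (p : M)
    (v : 'rV[R]_(dim M)) : 'rV[R]_(dim N) :=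
  'd (cmap (chart_at (f p)) \o f \o cinv (chart_at p))
     (cmap (chart_at p) p) v.

Definition submersion (R : realType) (M N : manifold R) (f : M -> N) : Prop :=
  smooth_map f /\
  forall (p : M) (w : 'rV[R]_(dim N)), exists v, tangent_map f p v = w.

Definition immersion (R : realType) (M N : manifold R) (f : M -> N) : Prop :=
  smooth_map f /\ forall p : M, injective (tangent_map f p).

(* The derivative v(f) at p of a function f defined on a submanifold S (values
   of f outside S are irrelevant), for v tangent to S at p: differentiate any
   smooth local extension of f.  For v tangent to S the result does not depend
   on the extension chosen. *)
Definition tangent_deriv (R : realType) (M : manifold R) (S : set M)
    (f : M -> R) (p : M) (v : 'rV[R]_(dim M)) : R :=
  let c := chart_at p in
  let F : 'rV[R]_(dim M) -> R^o :=
    xget (fun=> 0) [set F : 'rV[R]_(dim M) -> R^o |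
      is_extension_at (ccod c `&` cinv c @^-1` S) (f \o cinv c) (cmap c p) F] in
  'd F (cmap c p) v.

(* Smoothness of a product m : G_2 -> G, for G_2 = S a subset of G x G, read in
   charts of the two factors. *)
Definition smooth_product (R : realType) (G : manifold R) (S : set (G * G))
    (m : G -> G -> G) : Prop :=
  {within S, continuous (fun z : G * G => m z.1 z.2)} /\
  forall c d e : chart R G (dim G), atlas c -> atlas d -> atlas e ->
    smooth_along
      [set z : 'rV[R]_(dim G) * 'rV[R]_(dim G) |
        [/\ ccod c z.1, ccod d z.2, S (cinv c z.1, cinv d z.2) &
            cdom e (m (cinv c z.1) (cinv d z.2))]]
      (fun z => cmap e (m (cinv c z.1) (cinv d z.2))).

(* [mul] is total; only its values on composable pairs matter.  Products are
   written left to right: [mul g h] requires tgt g = src h. *)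
Record lie_groupoid (R : realType) := LieGroupoid {
  arr : manifold R;
  base : manifold R;
  src : arr -> base;
  tgt : arr -> base;
  idn : base -> arr;
  inv : arr -> arr;
  mul : arr -> arr -> arr;
  src_submersion : submersion src;
  tgt_submersion : submersion tgt;
  src_surj : forall x, exists g, src g = x;
  tgt_surj : forall x, exists g, tgt g = x;
  idn_smooth : smooth_map idn;
  inv_smooth : smooth_map inv;
  mul_smooth : smooth_product [set z | tgt z.1 = src z.2] mul;
  src_mul : forall g h, tgt g = src h -> src (mul g h) = src g;
  tgt_mul : forall g h, tgt g = src h -> tgt (mul g h) = tgt h;
  mulA : forall g h k, tgt g = src h -> tgt h = src k ->
    mul (mul g h) k = mul g (mul h k);
  src_idn : forall x, src (idn x) = x;
  tgt_idn : forall x, tgt (idn x) = x;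
  mul_idl : forall g, mul (idn (src g)) g = g;
  mul_idr : forall g, mul g (idn (tgt g)) = g;
  src_inv : forall g, src (inv g) = tgt g;
  tgt_inv : forall g, tgt (inv g) = src g;
  mul_invr : forall g, mul g (inv g) = idn (src g);
  mul_invl : forall g, mul (inv g) g = idn (tgt g)
}.

Definition composable (R : realType) (G : lie_groupoid R) (g h : arr G) : Prop :=
  tgt g = src h.

Definition ltrans (R : realType) (G : lie_groupoid R) (g : arr G) :
    arr G -> arr G := fun k => mul g k.

Definition rtrans (R : realType) (G : lie_groupoid R) (g : arr G) :
    arr G -> arr G := fun k => mul k g.

(* A_x G, as a subspace of the tangent space of G at the identity of x. *)
Definition algebroid (R : realType) (G : lie_groupoid R) (x : base G) :
    set 'rV[R]_(dim (arr G)) :=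
  [set v | tangent_map (@src R G) (idn x) v = 0].

(* The covector D_DEL L(g,h); it is meaningful on [algebroid (tgt g)]. *)
Definition Ddel (R : realType) (G : lie_groupoid R) (L : arr G -> R)
    (g h : arr G) (v : 'rV[R]_(dim (arr G))) : R :=
  tangent_deriv [set k | src k = tgt g]
    (fun k => (L \o ltrans g) k + (L \o rtrans h \o @inv R G) k)
    (idn (tgt g)) v.

Definition del_solution (R : realType) (G : lie_groupoid R) (L : arr G -> R)
    (g h : arr G) : Prop :=
  composable g h /\ forall v, algebroid (tgt g) v -> Ddel L g h v = 0.

(* Phi0 is not extra data: it is the base map induced by Phi. *)
Definition lie_groupoid_morphism (R : realType) (G G' : lie_groupoid R)
    (Phi : arr G -> arr G') (Phi0 : base G -> base G') : Prop :=
  [/\ smooth_map Phi,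
      forall g h, composable g h -> composable (Phi g) (Phi h),
      forall g h, composable g h -> Phi (mul g h) = mul (Phi g) (Phi h) &
      forall x, Phi0 x = src (Phi (idn x))].

Definition im_algebroid (R : realType) (G G' : lie_groupoid R)
    (Phi : arr G -> arr G') (x : base G) : set 'rV[R]_(dim (arr G')) :=
  tangent_map Phi (idn x) @` algebroid x.

(* Main.v *)
From HB Require Import structures.
Require Import Defs.
From mathcomp Require Import all_boot all_order all_algebra.
From mathcomp Require Import all_classical all_reals all_analysis.
From mathcomp Require Import ring lra.

(** Everything rests on one identity: for v in the Lie algebroid at the target
    of g, [D_DEL L(g,h)(v) = D_DEL L'(Phi g, Phi h)(T Phi v)] ([Ddel_morph]).

    Write f k = L(gk) + L(k^-1 h) on the source fibre S of the unit at
    [tgt g], and f' for the function built in the same way from L', Phi g and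
    Phi h on the source fibre S' of the corresponding unit.  A morphism sends S
    into S', preserves units, products and inverses, and L = L' o Phi; hence
    f = f' o Phi on S, and the identity is the chain rule.  The work is in
    applying the chain rule to derivatives along a submanifold that are defined
    by differentiating an arbitrarily chosen smooth local extension.

    Existence of an extension of f' ([mul_extension]): the product has smooth
    local extensions off the composable pairs, and these are composed with
    charts and with L'.  Composing with Phi then gives an extension of f
    ([extends_at_comp]).  This needs smoothness to be stable under composition,
    proved by induction on the order of differentiability ([Ck_on_comp]).

    Independence of the extension ([tangent_derivE]): two extensions agree on
    the source fibre, and their differentials must be shown to agree on the
    kernel of the differential of the source map.  The source map is a submersion, so
    a contraction argument produces points of the fibre of the form x + t u
    with t arbitrarily small and u arbitrarily close to a given kernel vector
    ([level_set_tangent]); a function vanishing on the fibre is thus stationary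
    in the direction of that vector.

    Part (i) follows because T Phi maps the algebroid of G into that of G'
    ([morph_algebroid]), and part (iii) because the identity holds for all v
    in the algebroid.  For part (ii), T Phi is onto between the algebroids as
    soon as Phi is a submersion: a preimage u of a source-vertical vector is
    made source-vertical by subtracting T(idn o src) u, which T Phi maps to 0
    ([submersion_algebroid_surj]). *)

Set Implicit Arguments.
Unset Strict Implicit.
Unset Printing Implicit Defensive.
Import Order.TTheory GRing.Theory Num.Theory.
Import numFieldNormedType.Exports.
(* The algebra libraries also have names such as [dim], [mul] and [inv]; the
   manifold and groupoid ones are meant throughout. *)
Import Defs.
Local Open Scope classical_set_scope.
Local Open Scope ring_scope.

(** * Locality of differentiation *)

Section NearEq.
Variables (R : realType) (V W : normedModType R).

(** The zero map is a differential of f, so uniqueness of the differential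
    identifies it with ['d f x]. *)
Lemma differentiable_near0 (f : V -> W) (x : V) :
  (\near x, f x = 0) -> differentiable f x.
Proof.
move=> f0; apply/diff_locallyP.
have Hlin : f \o shift x = cst (f x) + (cst 0 : V -> W) +o_ 0 id.
  apply/eqaddoP => e e0.
  move: f0; rewrite (near_shift 0) => f0.
  apply: filterS (f0) => h /=; rewrite subr0 => fh.
  have := nbhs_singleton f0; rewrite /= subr0 add0r => fx.
  by rewrite !fctE /= fh fx addr0 subr0 normr0 mulr_ge0 // ltW.
have d0 := @diff_unique _ _ _ f \0 x (@cst_continuous _ _ 0) Hlin.
by rewrite d0; split; [exact: cst_continuous|].
Unshelve. all: by end_near. Qed.

Lemma near_eq_differentiable (f g : V -> W) (x : V) :
  (\near x, f x = g x) -> differentiable f x -> differentiable g x.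
Proof.
move=> fg df; have -> : g = f + (g - f) by rewrite addrC subrK.
apply: differentiableD => //; apply: differentiable_near0.
by apply: filterS fg => y /= fgy; rewrite !fctE fgy subrr.
Qed.

Lemma near_eq_diff (f g : V -> W) (x v : V) :
  (\near x, f x = g x) -> differentiable f x -> 'd f x v = 'd g x v.
Proof.
move=> fg df; have dg := near_eq_differentiable fg df.
by rewrite -!deriveE //; exact: near_eq_derive.
Qed.

Lemma near_eq_continuous (f g : V -> W) (x : V) :
  (\near x, f x = g x) -> {for x, continuous f} -> {for x, continuous g}.
Proof.
move=> fg cf; have fgx : f x = g x := nbhs_singleton fg.
rewrite /prop_for /continuous_at -fgx; apply: cvg_trans cf; apply: near_eq_cvg.
by apply: filterS fg => y ->.
Qed.

Lemma diff_le_near (f : V -> W) (x : V) (e : R) : differentiable f x -> 0 < e ->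
  \forall y \near x, `|f y - f x - 'd f x (y - x)| <= e * `|y - x|.
Proof.
move=> /diff_locally /eqaddoP df e0.
rewrite (near_shift 0) /=; apply: filterS (df e e0) => h.
by rewrite !fctE /= subr0 addrK opprD addrA.
Qed.

End NearEq.

(** * Maps of class C^k *)

Section CkBasics.
Variables (R : realType) (V W : normedModType R).
Implicit Types (U : set V) (f : V -> W).

Lemma Ck_onS k U f : Ck_on k.+1 U f -> Ck_on k U f.
Proof.
elim: k f => [|k IH] f; first by move=> [df _] x /df/differentiable_continuous.
by move=> [df Df]; split=> // v; apply: IH; exact: Df.
Qed.

Lemma Ck_on_continuous k U f : Ck_on k U f ->
  forall x, U x -> {for x, continuous f}.
Proof. by elim: k f => // k IH f /Ck_onS/IH. Qed.

Lemma Ck_on_sub k U U' f : U' `<=` U -> Ck_on k U f -> Ck_on k U' f.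
Proof.
move=> sU; elim: k f => [|k IH] f /=; first by move=> cf x /sU/cf.
by move=> [df Df]; split=> [x /sU/df //|v]; exact: IH.
Qed.

(** Openness of U is what lets derivatives depend on the values on U only. *)
Lemma Ck_on_eq k U f g : open U -> (forall x, U x -> f x = g x) ->
  Ck_on k U f -> Ck_on k U g.
Proof.
move=> oU; have near_fg (f1 g1 : V -> W) x : (forall x, U x -> f1 x = g1 x) ->
    U x -> \near x, f1 x = g1 x.
  by move=> fg Ux; apply: filterS (open_nbhs_nbhs (conj oU Ux)); exact: fg.
elim: k f g => [|k IH] f g fg /=.
  by move=> cf x Ux; apply: near_eq_continuous (cf x Ux); exact: near_fg.
move=> [df Df]; split=> [x Ux|v].
  by apply: near_eq_differentiable (df x Ux); exact: near_fg.
apply: IH (Df v) => x Ux; apply: near_eq_derive; exact: near_fg.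
Qed.

Lemma Ck_on_cst k U (a : W) : Ck_on k U (cst a).
Proof.
elim: k a => [|k IH] a /=; first by move=> x _; exact: cst_continuous.
split=> [x _|v]; first exact: differentiable_cst.
suff -> : 'D_v (cst a) = cst 0 :> (V -> W) by exact: IH.
by apply/funext => x; rewrite derive_cst.
Qed.

Lemma Ck_on_add k U f g : open U ->
  Ck_on k U f -> Ck_on k U g -> Ck_on k U (f + g).
Proof.
move=> oU; elim: k f g => [|k IH] f g /=.
  by move=> cf cg x Ux; apply: continuousD; [exact: cf|exact: cg].
move=> [df Df] [dg Dg]; split=> [x Ux|v].
  by apply: differentiableD; [exact: df|exact: dg].
apply: Ck_on_eq (IH _ _ (Df v) (Dg v)) => // x Ux.
by rewrite deriveD //; apply: diff_derivable; [exact: df|exact: dg].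
Qed.

Lemma Ck_on_sum (I : finType) k U (F : I -> V -> W) : open U ->
  (forall i, Ck_on k U (F i)) -> Ck_on k U (fun x => \sum_i F i x).
Proof.
move=> oU FC; elim: (index_enum I) => [|i r IH].
  by under eq_fun do rewrite big_nil; exact: Ck_on_cst.
by under eq_fun do rewrite big_cons; exact: Ck_on_add.
Qed.

End CkBasics.

Section CkComp.
Variables (R : realType).

Lemma Ck_on_linear (V W Z : normedModType R) k (U : set V) (f : V -> W)
    (l : {linear W -> Z}) : open U -> continuous l ->
  Ck_on k U f -> Ck_on k U (l \o f).
Proof.
move=> oU cl; elim: k f => [|k IH] f /=.
  move=> cf x Ux; apply: continuous_comp; [exact: cf|exact: cl].
move=> [df Df]; split=> [x Ux|v].
  by apply: differentiable_comp; [exact: df|exact: linear_differentiable].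
apply: Ck_on_eq (IH _ (Df v)) => // x Ux /=.
have dl : differentiable l (f x) by exact: linear_differentiable.
rewrite !deriveE; last by apply: df.
  by rewrite (diff_comp (df x Ux) dl) /= diff_lin.
by apply: differentiable_comp => //; exact: df.
Qed.

(** Scaling is a bilinear map, so its differentiability and its product rule are
    those of bilinear maps. *)
Lemma scale_is_bilinear (W : normedModType R) :
  bilinear_for
    (GRing.Scale.Law.clone _ _ *:%R _) (GRing.Scale.Law.clone _ _ *:%R _)
    (fun (a : R^o) (w : W) => a *: w).
Proof.
split=> [w|u] a x y /=; first by rewrite scalerDl scalerA.
by rewrite scalerDr !scalerA mulrC.
Qed.

Lemma is_diff_scale (V W : normedModType R) (a : V -> R^o) (f : V -> W)
    (x : V) :
  differentiable a x -> differentiable f x ->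
  is_diff x (fun y => a y *: f y) (fun v => a x *: 'd f x v + 'd a x v *: f x).
Proof.
move=> da df.
pose m := bilinear_isBilinear.Build R _ _ _ _ _ _ (@scale_is_bilinear W).
pose b : {bilinear R^o -> W -> W} :=
  HB.pack (fun (a : R^o) (w : W) => a *: w) m.
have bc : continuous (fun p : R^o * W => b p.1 p.2).
  by move=> p; apply: cvgZ; [exact: cvg_fst|exact: cvg_snd].
have db : differentiable (fun p : R^o * W => b p.1 p.2) (a x, f x).
  exact: differentiable_bilin.
have dp : differentiable (fun y => (a y, f y)) x by exact: differentiable_pair.
have -> : (fun y => a y *: f y) =
    (fun p : R^o * W => b p.1 p.2) \o (fun y => (a y, f y)).
  by [].
apply: DiffDef; first exact: differentiable_comp.
rewrite diff_comp //; apply/funext => v.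
by rewrite [LHS](congr1 (@^~ _) (diff_bilin _ bc)) diff_pair.
Qed.

Lemma Ck_on_scale (V W : normedModType R) k (U : set V) (a : V -> R^o)
    (f : V -> W) : open U ->
  Ck_on k U a -> Ck_on k U f -> Ck_on k U (fun x => a x *: f x).
Proof.
move=> oU; elim: k a f => [|k IH] a f.
  by move=> ca cf x Ux; apply: cvgZ; [exact: ca|exact: cf].
move=> Ca Cf; have [[da Da] [df Df]] := (Ca, Cf).
split=> [x Ux|v]; first by have [] := is_diff_scale (da x Ux) (df x Ux).
pose h := (fun x => a x *: 'D_v f x) + (fun x => 'D_v a x *: f x).
apply: (@Ck_on_eq _ _ _ _ _ h) => //; last first.
  apply: Ck_on_add => //; apply: IH.
  - exact: Ck_onS.
  - exact: Df.
  - exact: Da.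
  - exact: Ck_onS.
move=> x Ux; have [dh hE] := is_diff_scale (da x Ux) (df x Ux).
have [dax dfx] := (da x Ux, df x Ux).
rewrite [RHS](deriveE v dh) hE.
by congr (a x *: _ + _ *: f x); exact: deriveE.
Qed.

(** Finite dimension, as a finite basis with continuous coordinate forms: the
    form in which the chain rule uses it to expand ['d g] along partial
    derivatives. *)
Definition has_coordinates (W : normedModType R) : Prop :=
  exists (I : finType) (e : I -> W) (l : I -> {linear W -> R^o}),
    (forall i, continuous (l i)) /\ (forall w, w = \sum_i l i w *: e i).

(** The derivative of g o f along v is the sum over i of
    [l i ('D_v f) *: ('D_(e i) g) o f]: each factor is one order less regular,
    which makes the induction work with f fixed and g varying. *)
Lemma Ck_on_comp (V W Z : normedModType R) k (U : set V) (U' : set W)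
    (f : V -> W) (g : W -> Z) : has_coordinates W ->
  open U -> open U' -> U `<=` f @^-1` U' ->
  Ck_on k U f -> Ck_on k U' g -> Ck_on k U (g \o f).
Proof.
move=> [I [e [l [cl lE]]]] oU oU' UU'.
elim: k g => [|k IH] g.
  move=> cf cg x Ux; apply: continuous_comp; first exact: cf.
  by apply: cg; exact: UU'.
move=> Cf Cg; have [[df Df] [dg Dg]] := (Cf, Cg).
split=> [x Ux|v].
  by apply: differentiable_comp; [exact: df|apply: dg; exact: UU'].
pose h x := \sum_i l i ('D_v f x) *: 'D_(e i) g (f x).
apply: (@Ck_on_eq _ _ _ _ _ h) => //; last first.
  apply: Ck_on_sum => // i; apply: Ck_on_scale => //.
    exact: (@Ck_on_linear _ _ _ _ _ ('D_v f) (l i) oU (cl i) (Df v)).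
  by apply: (IH ('D_(e i) g)); [exact: Ck_onS|exact: Dg].
move=> x Ux; rewrite /h; have dgx : differentiable g (f x).
  by apply: dg; exact: UU'.
rewrite [RHS]deriveE; last by apply: differentiable_comp => //; exact: df.
rewrite diff_comp //; last exact: df.
rewrite /= [in RHS](lE ('d f x v)) linear_sum.
by apply: eq_bigr => i _; rewrite linearZ /= !deriveE //; exact: df.
Qed.

End CkComp.

Section SmoothAt.
Variables (R : realType).

Lemma Ck_on_pair (V W Z : normedModType R) k (U : set V) (f : V -> W)
    (g : V -> Z) : open U ->
  Ck_on k U f -> Ck_on k U g -> Ck_on k U (fun x => (f x, g x)).
Proof.
move=> oU; elim: k f g => [|k IH] f g.
  by move=> cf cg x Ux; apply: cvg_pair; [exact: cf|exact: cg].
move=> [df Df] [dg Dg]; split=> [x Ux|v].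
  by apply: differentiable_pair; [exact: df|exact: dg].
apply: Ck_on_eq (IH _ _ (Df v) (Dg v)) => // x Ux.
have [dfx dgx] := (df x Ux, dg x Ux).
rewrite [RHS]deriveE; last exact: differentiable_pair.
by rewrite diff_pair // !deriveE.
Qed.

Lemma rV_has_coordinates n : has_coordinates 'rV[R]_n.
Proof.
pose l (i : 'I_n) (w : 'rV[R]_n) : R^o := w ord0 i.
have l_lin i : linear (l i) by move=> a x y; rewrite /l !mxE.
pose L i : {linear 'rV[R]_n -> R^o} :=
  HB.pack (l i) (GRing.isLinear.Build _ _ _ _ (l i) (l_lin i)).
exists 'I_n, (fun i => delta_mx ord0 i), L; split=> [i|w].
  exact: coord_continuous.
exact: row_sum_delta.
Qed.

Lemma prod_has_coordinates (V W : normedModType R) :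
  has_coordinates V -> has_coordinates W -> has_coordinates (V * W)%type.
Proof.
move=> [I [e [l [cl lE]]]] [J [d [m [cm mE]]]].
pose c (k : I + J) (p : V * W) : R^o :=
  match k with inl i => l i p.1 | inr j => m j p.2 end.
have c_lin k : linear (c k) by case: k => i a x y; rewrite /c /= linearP.
pose C k : {linear (V * W)%type -> R^o} :=
  HB.pack (c k) (GRing.isLinear.Build _ _ _ _ (c k) (c_lin k)).
exists (I + J)%type,
  (fun k => match k with inl i => (e i, 0) | inr j => (0, d j) end), C.
split=> [[i|j] p|[v w]].
- by apply: continuous_comp; [exact: cvg_fst|exact: cl].
- by apply: continuous_comp; [exact: cvg_snd|exact: cm].
rewrite big_sumType /= {1}(lE v) {1}(mE w).
rewrite -[LHS]/(\sum_i l i v *: e i, \sum_j m j w *: d j).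
have fst_sum : \sum_i (l i v *: e i, 0 : W) = (\sum_i l i v *: e i, 0).
  elim/big_rec2: _ => // i y _ _ ->; congr pair; exact: addr0.
have snd_sum : \sum_j (0 : V, m j w *: d j) = (0, \sum_j m j w *: d j).
  elim/big_rec2: _ => // i y _ _ ->; congr pair; exact: addr0.
under eq_bigr do rewrite -[_ *: _]/(_ *: _, _ *: _) scaler0.
under [X in _ + X]eq_bigr do rewrite -[_ *: _]/(_ *: _, _ *: _) scaler0.
by rewrite fst_sum snd_sum; congr pair; rewrite /= (addr0, add0r).
Qed.

(** * Smooth germs *)

Variables (V W : normedModType R).

(** One neighbourhood serves all orders, as for [smooth_on]. *)
Definition smooth_at (f : V -> W) (x : V) : Prop :=
  exists U : set V, [/\ open U, U x & smooth_on U f].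

Lemma smooth_at_diff f x : smooth_at f x -> differentiable f x.
Proof. by move=> [U [_ Ux /(_ 1)[df _]]]; exact: df. Qed.

Lemma smooth_at_add f g x :
  smooth_at f x -> smooth_at g x -> smooth_at (f + g) x.
Proof.
move=> [U [oU Ux sf]] [U' [oU' U'x sg]]; have oUU' := openI oU oU'.
exists (U `&` U'); split=> // k; apply: Ck_on_add => //.
  by apply: Ck_on_sub (sf k) => y [].
by apply: Ck_on_sub (sg k) => y [].
Qed.

(** Separates the two requirements on an extension, so that smoothness can be
    handled by the germ lemmas and agreement by filters. *)
Lemma is_extension_atP (D : set V) (f : V -> W) x F :
  is_extension_at D f x F <->
  smooth_at F x /\ \forall y \near x, D y -> F y = f y.
Proof.
split=> [[U [oU Ux sF FE]]|[[U [oU Ux sF]] FE]].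
  split; first by exists U.
  by apply: filterS (open_nbhs_nbhs (conj oU Ux)) => y Uy; exact: FE.
exists (U `&` [set y | D y -> F y = f y]°); split.
- by apply: openI => //; exact: open_interior.
- by split=> //; exact: FE.
- by move=> k; apply: Ck_on_sub (sF k) => y [].
- by move=> y [_ /interior_subset]; exact.
Qed.

End SmoothAt.

Lemma smooth_at_pair (R : realType) (V W Z : normedModType R) (f : V -> W)
    (g : V -> Z) x :
  smooth_at f x -> smooth_at g x -> smooth_at (fun y => (f y, g y)) x.
Proof.
move=> [U [oU Ux sf]] [U' [oU' U'x sg]]; have oUU' := openI oU oU'.
exists (U `&` U'); split=> // k; apply: Ck_on_pair => //.
  by apply: Ck_on_sub (sf k) => y [].
by apply: Ck_on_sub (sg k) => y [].
Qed.

Lemma smooth_at_comp (R : realType) (V W Z : normedModType R) (f : V -> W)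
    (g : W -> Z) x : has_coordinates W ->
  smooth_at f x -> smooth_at g (f x) -> smooth_at (g \o f) x.
Proof.
move=> cW [U [oU Ux sf]] [U' [oU' U'fx sg]].
pose N := U `&` (f @^-1` U')°.
have oN : open N by apply: openI => //; exact: open_interior.
exists N; split=> //.
  split=> //; apply: (Ck_on_continuous (sf 0) Ux).
  exact: (open_nbhs_nbhs (conj oU' U'fx)).
move=> k; apply: (@Ck_on_comp _ _ _ _ _ _ U') => //.
  by move=> y [_ /interior_subset].
by apply: Ck_on_sub (sf k) => y [].
Qed.

(** * Strict differentiability *)

Section StrictDifferentiability.
Variables (R : realType).

Lemma rV_norm_le n (w : 'rV[R]_n) (c : R) : 0 <= c ->
  (forall i, `|w ord0 i| <= c) -> `|w| <= c.
Proof.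
move=> c0 wc; rewrite [leLHS]/Num.norm /= mx_normrE.
by apply: bigmax_le => // -[i j] _; rewrite /= (ord1 i).
Qed.

Lemma rV_coord_le_norm n (w : 'rV[R]_n) i : `|w ord0 i| <= `|w|.
Proof.
rewrite [leRHS]/Num.norm /= mx_normrE.
exact: (le_bigmax _ (fun ij : 'I_1 * 'I_n => `|w ij.1 ij.2|) (ord0, i)).
Qed.

(** The one-variable mean value theorem for t |-> g (a + t (b - a)). *)
Lemma mean_value_le (V : normedModType R) (g : V -> R) (a b : V) (M : R) :
  (forall t : R, 0 <= t <= 1 -> differentiable g (a + t *: (b - a)) /\
     `|'d g (a + t *: (b - a)) (b - a)| <= M) -> `|g b - g a| <= M.
Proof.
move=> gM; pose p (t : R) := a + t *: (b - a).
have dp t : is_diff t p (fun u => u *: (b - a)).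
  by apply: is_diff_eq; rewrite add0r.
have dgp (t : R) : 0 <= t <= 1 ->
    is_diff t (g \o p) (fun u => 'd g (p t) (u *: (b - a))).
  move=> /gM[dg _]; have dg' := differentiableP dg.
  exact: is_diff_comp.
have [||c c01] := @MVT R (g \o p) (fun t => 'd g (p t) (b - a)) 0 1 ltr01.
- move=> t t01.
  have [dgt dE] : is_diff t (g \o p) (fun u => 'd g (p t) (u *: (b - a))).
    by apply: dgp; move: t01; rewrite in_itv /= => /andP[/ltW-> /ltW].
  apply: DeriveDef; first exact: diff_derivable.
  by rewrite deriveE // dE scale1r.
- apply: continuous_in_subspaceT => t; rewrite inE /= in_itv /= => t01.
  by have [/differentiable_continuous ? _] := dgp t t01.
rewrite subr0 mulr1 /p /= scale0r scale1r addr0 [a + _]addrC subrK => ->.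
by apply: (gM c _).2; move: c01; rewrite in_itv /= => /andP[/ltW-> /ltW].
Qed.

Lemma linear_rV_sum (W : lmodType R) n (A : {linear 'rV[R]_n -> W}) v :
  A v = \sum_j v ord0 j *: A (delta_mx ord0 j).
Proof.
rewrite [in LHS](row_sum_delta v) linear_sum.
by apply: eq_bigr => j _; rewrite linearZ.
Qed.

(** The factor n + 1 in place of n covers dimension 0 without a case split. *)
Lemma linear_dist_le (W : normedModType R) n (A B : {linear 'rV[R]_n -> W}) e v :
  0 <= e ->
  (forall j, `|A (delta_mx ord0 j) - B (delta_mx ord0 j)| <= e / n.+1%:R) ->
  `|A v - B v| <= e * `|v|.
Proof.
move=> e0 AB; rewrite (linear_rV_sum A) (linear_rV_sum B) -sumrB.
apply: le_trans (ler_norm_sum _ _ _) _.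
apply: (@le_trans _ _ (\sum_(j < n) e / n.+1%:R * `|v|)).
  apply: ler_sum => j _; rewrite -scalerBr normrZ mulrC.
  by apply: ler_pM;
    [exact: normr_ge0|exact: normr_ge0|exact: AB|exact: rV_coord_le_norm].
rewrite sumr_const card_ord -mulrnAl ler_wpM2r // -mulr_natr mulrAC.
by rewrite ler_pdivrMr // ler_wpM2l // ler_nat.
Qed.

(** The partial derivatives are continuous at x, and finitely many of them
    control the differential. *)
Lemma smooth_at_diff_near n m (s : 'rV[R]_n -> 'rV[R]_m) (x : 'rV[R]_n) e :
  smooth_at s x -> 0 < e ->
  \forall y \near x, differentiable s y /\
    forall v, `|'d s y v - 'd s x v| <= e * `|v|.
Proof.
move=> [U [oU Ux ss]] e0; have [ds Ds] := ss 1.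
pose e' := e / n.+1%:R; have e'0 : 0 < e' by rewrite divr_gt0.
have nearD : \forall y \near x, forall j : 'I_n,
    `|'D_(delta_mx ord0 j) s y - 'D_(delta_mx ord0 j) s x| <= e'.
  apply: (@filter_forall _ _ _ _ (nbhs_filter x)) => j.
  have /cvgrPdistC_le/(_ e' e'0) := Ds (delta_mx ord0 j) x Ux.
  exact.
have nearU : \forall y \near x, U y by exact: (open_nbhs_nbhs (conj oU Ux)).
near=> y.
have Uy : U y by near: y.
have dsy := ds y Uy; have dsx := ds x Ux.
split=> [|v]; first exact: dsy.
apply: linear_dist_le => [|j]; first exact: ltW.
have Dy : `|'D_(delta_mx ord0 j) s y - 'D_(delta_mx ord0 j) s x| <= e'.
  by move: j; near: y; exact: nearD.
apply: le_trans Dy; rewrite le_eqVlt; apply/orP; left; apply/eqP.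
congr (`| _ - _ |); exact/esym/deriveE.
Unshelve. all: by end_near. Qed.

Lemma is_diff_coord n (w : 'rV[R]_n) i :
  is_diff w (fun u : 'rV[R]_n => u ord0 i : R) (fun u => u ord0 i).
Proof.
have @l : {linear 'rV[R]_n -> R}.
  by exists (fun u : 'rV[R]_n => u ord0 i); do 2![eexists]; do ?[constructor];
     rewrite ?mxE// => ? *; rewrite ?mxE//; move=> ?; rewrite !mxE.
rewrite (_ : (fun u => _) = l) //.
have cl : continuous l by exact: coord_continuous.
by apply: DiffDef; [exact: linear_differentiable|exact: diff_lin].
Qed.

Lemma is_diff_sub_coord (V : normedModType R) m (s ds : V -> 'rV[R]_m)
    (A dA : V -> 'rV[R]_m) p i : is_diff p s ds -> is_diff p A dA ->
  is_diff p (fun w => (s w - A w) ord0 i : R) (fun v => (ds v - dA v) ord0 i).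
Proof.
move=> dsp dAp; have dd : is_diff p (s - A) (ds - dA) by exact: is_diffB.
exact: (is_diff_comp dd (is_diff_coord _ i)).
Qed.

(** Applied coordinatewise to s - A, since the mean value theorem fails for
    vector-valued maps but the norm is the maximum of the coordinates. *)
Lemma mean_value_linear_le (V : normedModType R) m (s : V -> 'rV[R]_m)
    (A : {linear V -> 'rV[R]_m}) (y z : V) (M : R) : continuous A ->
  (forall t : R, 0 <= t <= 1 -> differentiable s (z + t *: (y - z)) /\
     `|'d s (z + t *: (y - z)) (y - z) - A (y - z)| <= M) ->
  `|s y - s z - A (y - z)| <= M.
Proof.
move=> cA sM; have M0 : 0 <= M.
  have [_] := sM 0 (introT andP (conj (lexx _) ler01)).
  by apply: le_trans; exact: normr_ge0.
apply: rV_norm_le => // i.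
pose g (w : V) : R := (s w - A w) ord0 i.
have -> : (s y - s z - A (y - z)) ord0 i = g y - g z.
  by rewrite /g linearB !mxE; ring.
apply: mean_value_le => t /sM[]; set p := z + _ => dsp sp.
have dA : is_diff p A A.
  by apply: DiffDef; [exact: linear_differentiable|exact: diff_lin].
have [dg dgE] := is_diff_sub_coord i (differentiableP dsp) dA.
split; first exact: dg.
by rewrite dgE; apply: le_trans sp; exact: rV_coord_le_norm.
Qed.

(** Unlike in differentiability at x, both points vary around x: this is what
    makes the map of [level_set_tangent] contracting. *)
Definition strictly_differentiable (V W : normedModType R) (s : V -> W)
    (x : V) : Prop :=
  forall e, 0 < e -> \forall d \near 0^'+, forall y z,
    `|y - x| < d -> `|z - x| < d ->
    `|s y - s z - 'd s x (y - z)| <= e * `|y - z|.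

Lemma ball_convex (V : normedModType R) (x y z : V) (d t : R) : 0 <= t <= 1 ->
  `|y - x| < d -> `|z - x| < d -> `|z + t *: (y - z) - x| < d.
Proof.
move=> /andP[t0 t1] yx zx.
have -> : z + t *: (y - z) - x = t *: (y - x) + (1 - t) *: (z - x).
  have -> : y - z = (y - x) - (z - x) by rewrite opprB addrA subrK.
  by rewrite scalerBr scalerBl scale1r addrAC [RHS]addrCA.
apply: le_lt_trans (ler_normD _ _) _; rewrite !normrZ !ger0_norm ?subr_ge0 //.
pose M := Num.max `|y - x| `|z - x|.
have Md : M < d by rewrite gt_max yx zx.
have yM : `|y - x| <= M by rewrite le_max lexx.
have zM : `|z - x| <= M by rewrite le_max lexx orbT.
by nra.
Qed.

Lemma smooth_at_strict n m (s : 'rV[R]_n -> 'rV[R]_m) (x : 'rV[R]_n) :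
  smooth_at s x -> strictly_differentiable s x.
Proof.
move=> ss e e0; have dsx := smooth_at_diff ss.
have /nbhs_normP[r /= r0 rP] := smooth_at_diff_near ss e0.
near=> d => y z yx zx.
have segP (t : R) : 0 <= t <= 1 -> differentiable s (z + t *: (y - z)) /\
    forall v, `|'d s (z + t *: (y - z)) v - 'd s x v| <= e * `|v|.
  move=> t01; apply: rP; rewrite /= distrC.
  apply: lt_le_trans (ball_convex t01 yx zx) _; near: d; exact: nbhs_right_le.
apply: mean_value_linear_le => [|t /segP[dst st]]; first exact: diff_continuous.
by split; [exact: dst|exact: st].
Unshelve. all: by end_near. Qed.
End StrictDifferentiability.

(** * Tangent vectors to level sets *)

Section LevelSets.
Variables (R : realType).

(** The bound on f 0 and the Lipschitz constant 1/2 together make the ball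
    stable, so that Banach's theorem applies. *)
Lemma contraction_ball_fixpoint (W : completeNormedModType R) (f : W -> W)
    (r : R) :
  0 <= r -> `|f 0| <= r / 2 ->
  (forall w1 w2, `|w1| <= r -> `|w2| <= r ->
    `|f w1 - f w2| <= 2^-1 * `|w1 - w2|) ->
  exists2 w, `|w| <= r & f w = w.
Proof.
move=> r0 f0 flip; pose U := [set w : W | `|w| <= r].
have fU : {homo f : w / U w >-> U w}.
  move=> w Uw; rewrite /U /= -(subrK (f 0) (f w)).
  apply: le_trans (ler_normD _ _) _; rewrite [leRHS]splitr lerD //.
  have := flip w 0 Uw; rewrite normr0 subr0 => /(_ r0) /le_trans; apply.
  by rewrite mulrC ler_pM2r // invr_gt0.
have half0 : 0 <= 2^-1 :> R by rewrite invr_ge0.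
have ctr : is_contraction (mkfun fU).
  exists (NngNum half0); split; first by rewrite /= invf_lt1 // ltr1n.
  by move=> [w1 w2] [/= U1 U2]; exact: flip.
have clU : closed U.
  have -> : U = closed_ball_ Num.norm 0 r; last exact: closed_closed_ball_.
  by apply/funext => w; rewrite /U /closed_ball_ /= sub0r normrN.
have U0 : U !=set0 by exists 0; rewrite /U /= normr0.
have [w Uw wf] := banach_fixed_point ctr clU U0.
by exists w; [exact: Uw|exact: esym wf].
Qed.

(** Look for u = v + B w with B a right inverse of ['d s x].  The equation
    s (x + t u) = s x is a fixed point problem for
    w |-> w - t^-1 (s (x + t (v + B w)) - s x); dividing by t keeps the unknown w
    in a ball whose radius does not depend on t.  Since ['d s x] kills v and
    inverts B, strict differentiability makes this map small at 0 and
    contracting. *)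
Lemma level_set_tangent (V : normedModType R) (W : completeNormedModType R)
    (s : V -> W) (x : V) (B : {linear W -> V}) (v : V) :
  strictly_differentiable s x -> continuous B ->
  (forall w, 'd s x (B w) = w) -> 'd s x v = 0 ->
  forall e, 0 < e ->
    \forall t \near 0^'+, exists2 u, `|u - v| <= e & s (x + t *: u) = s x.
Proof.
move=> ss cB dsB dsv e e0; have [k k0 Bk] := linear_lipschitz cB.
(* The constant 1/(2k) min(1, e/(|v|+1)) gives c k <= 1/2, the contraction
   factor, and c |v| <= (e/k)/2, the bound at 0 for the ball of radius e/k. *)
pose c := k^-1 / 2 * Num.min 1 (e / (`|v| + 1)).
have v1 : 0 < `|v| + 1 by rewrite ltr_wpDl.
have c0 : 0 < c by rewrite /c !mulr_gt0 ?invr_gt0 // lt_min ltr01 divr_gt0.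
have ck : c * k <= 2^-1.
  have -> : c * k = 2^-1 * Num.min 1 (e / (`|v| + 1)).
    by rewrite /c; field; rewrite gt_eqF.
  by rewrite ger_pMr ?invr_gt0 // ge_min lexx.
have cv : c * `|v| <= e / k / 2.
  have -> : e / k / 2 = k^-1 / 2 * (e / (`|v| + 1)) * (`|v| + 1).
    by field; rewrite !gt_eqF.
  apply: ler_pM; [exact: ltW|by []| |by rewrite lerDl].
  by rewrite /c ler_pM2l ?mulr_gt0 ?invr_gt0 // ge_min lexx orbT.
have [d [d0 dP]] : exists d, 0 < d /\ forall y z,
    `|y - x| < d -> `|z - x| < d ->
    `|s y - s z - 'd s x (y - z)| <= c * `|y - z|.
  near (0 : R)^'+ => d; exists d; split; near: d.
  - exact: nbhs_right_gt.
  - exact: ss.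
near=> t.
have t0 : 0 < t by near: t; exact: nbhs_right_gt.
have td : t * (`|v| + e) < d.
  rewrite -ltr_pdivlMr; last by rewrite ltr_wpDl.
  by near: t; apply: nbhs_right_lt; rewrite divr_gt0 // ltr_wpDl.
have ek0 : 0 <= e / k by rewrite divr_ge0 // ltW.
pose y (w : W) := x + t *: (v + B w).
have Be w : `|w| <= e / k -> `|B w| <= e.
  by move=> we; apply: le_trans (Bk w) _; rewrite mulrC -ler_pdivlMr.
have yd w : `|w| <= e / k -> `|y w - x| < d.
  move=> we; rewrite /y addrC addKr normrZ gtr0_norm //.
  apply: le_lt_trans td; rewrite ler_pM2l //.
  by apply: le_trans (ler_normD _ _) _; rewrite lerD2l; exact: Be.
pose f (w : W) := w - t^-1 *: (s (y w) - s x).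
have [|w1 w2 w1e w2e|w we fw] := @contraction_ball_fixpoint W f (e / k) ek0.
- have B0 : `|0 : W| <= e / k by rewrite normr0.
  have := dP (y 0) x (yd 0 B0); rewrite subrr normr0 => /(_ d0).
  have -> : y 0 - x = t *: v by rewrite /y linear0 addr0 addrC addKr.
  rewrite /f linearZ /= dsv scaler0 subr0.
  rewrite sub0r normrN !normrZ normfV gtr0_norm // ler_pdivrMl //.
  by move=> /le_trans; apply; rewrite mulrCA ler_pM2l.
- have := dP _ _ (yd _ w1e) (yd _ w2e).
  have -> : y w1 - y w2 = t *: B (w1 - w2).
    rewrite /y opprD addrACA subrr add0r -scalerBr opprD addrACA subrr add0r.
    by congr (_ *: _); exact/esym/linearB.
  rewrite linearZ /= dsB => st.
  have -> : f w1 - f w2 =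
      - (t^-1 *: (s (y w1) - s (y w2) - t *: (w1 - w2))).
    have -> : s (y w1) - s (y w2) = (s (y w1) - s x) - (s (y w2) - s x).
      by rewrite opprB addrA subrK.
    rewrite /f; set p1 := s (y w1) - s x; set p2 := s (y w2) - s x.
    rewrite [X in _ = - X]scalerBr scalerA mulVf ?gt_eqF // scale1r.
    rewrite [_ *: (p1 - p2)]scalerBr !opprB addrACA [RHS]addrACA.
    by rewrite [- w2 + _]addrC.
  rewrite normrN normrZ normfV gtr0_norm // ler_pdivrMl //.
  apply: le_trans st _; rewrite normrZ gtr0_norm // mulrCA ler_pM2l //.
  apply: (@le_trans _ _ (c * (k * `|w1 - w2|))); first by rewrite ler_pM2l.
  by rewrite mulrA ler_wpM2r.
exists (v + B w); first by rewrite addrC addKr; exact: Be.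
have /eqP : t^-1 *: (s (y w) - s x) = 0.
  apply/eqP; rewrite -oppr_eq0; apply/eqP; apply: (addrI w).
  by rewrite addr0; exact: fw.
by rewrite scaler_eq0 invr_eq0 gt_eqF // subr_eq0 => /eqP.
Unshelve. all: by end_near. Qed.

(** Divide g (x + t u) = g x by t along the points x + t u of the level set
    given by [level_set_tangent], where u is close to v. *)
Lemma diff_vanish_on_level_set (V : normedModType R) (W : completeNormedModType R)
    (s : V -> W) (x : V) (B : {linear W -> V}) (v : V) (g : V -> R) :
  strictly_differentiable s x -> continuous B ->
  (forall w, 'd s x (B w) = w) -> 'd s x v = 0 ->
  differentiable g x -> (\forall y \near x, s y = s x -> g y = 0) ->
  'd g x v = 0.
Proof.
move=> ss cB dsB dsv dg g0.
have [k k0 dgk] := linear_lipschitz (diff_continuous dg).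
pose C := `|v| + 1 + k.
have C0 : 0 < C by rewrite ltr_wpDl // ltr_pwDl // ler_wpDl.
suff small (e : R) : 0 < e -> e <= 1 -> `|'d g x v| <= e * C.
  apply/eqP; rewrite -normr_eq0 eq_le normr_ge0 andbT.
  apply/ler_addgt0Pr => e e0; rewrite add0r; have := small (Num.min 1 (e / C)).
  rewrite lt_min ltr01 divr_gt0 // ge_min lexx => /(_ isT isT) /le_trans; apply.
  by rewrite -ler_pdivlMr // ge_min lexx orbT.
move=> e0 e1; have ltan := level_set_tangent ss cB dsB dsv e0.
have /nbhs_normP[r /= r0 rP] : \forall y \near x,
    (s y = s x -> g y = 0) /\ `|g y - g x - 'd g x (y - x)| <= e * `|y - x|.
  by apply: filterI => //; exact: diff_le_near.
near (0 : R)^'+ => t.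
have t0 : 0 < t by near: t; exact: nbhs_right_gt.
have [u uv su] : exists2 u, `|u - v| <= e & s (x + t *: u) = s x.
  by near: t; exact: ltan.
have u_le : `|u| <= `|v| + 1.
  rewrite -(subrK v u) addrC; apply: le_trans (ler_normD _ _) _.
  by rewrite lerD2l; apply: le_trans uv e1.
have xr : ball_ Num.norm x r (x + t *: u).
  rewrite /= opprD addrA subrr sub0r normrN normrZ gtr0_norm //.
  have tr : t * (`|v| + 1) < r.
    rewrite -ltr_pdivlMr ?ltr_wpDl //.
    by near: t; apply: nbhs_right_lt; rewrite divr_gt0 // ltr_wpDl.
  by apply: le_lt_trans tr; rewrite ler_pM2l.
have [gu gd] := rP _ xr.
have gx : g x = 0.
  by have [] := rP x; rewrite /= ?subrr ?normr0 // => /(_ erefl).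
move: gd; rewrite gu // gx subr0 sub0r normrN addrC addKr linearZ /=.
rewrite !normrZ gtr0_norm // mulrCA ler_pM2l // => gd.
have -> : 'd g x v = 'd g x u - 'd g x (u - v) by rewrite linearB /= subKr.
apply: le_trans (ler_normB _ _) _; rewrite /C mulrDr; apply: lerD.
  by apply: le_trans gd _; rewrite ler_pM2l.
by apply: le_trans (dgk _) _; rewrite mulrC ler_pM2r.
Unshelve. all: by end_near. Qed.

End LevelSets.

(** Makes the row vectors a complete normed module, as Banach's theorem needs. *)
HB.instance Definition _ (R : realType) (m n : nat) :=
  Uniform_isComplete.Build 'M[R]_(m, n) cauchy_cvg.

(** A right inverse of ['d s x] is built by lifting the standard basis. *)
Lemma diff_eq_on_level_set (R : realType) n m (s : 'rV[R]_n -> 'rV[R]_m)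
    (x v : 'rV[R]_n) (F1 F2 : 'rV[R]_n -> R) :
  smooth_at s x -> (forall w, exists u, 'd s x u = w) -> 'd s x v = 0 ->
  differentiable F1 x -> differentiable F2 x ->
  (\forall y \near x, s y = s x -> F1 y = F2 y) -> 'd F1 x v = 'd F2 x v.
Proof.
move=> ss surj dsv dF1 dF2 FE.
have [b bE] := choice (fun j : 'I_m => surj (delta_mx ord0 j)).
pose B0 (w : 'rV[R]_m) := \sum_j w ord0 j *: b j.
have B0_lin : linear B0.
  move=> a u w; rewrite /B0 scaler_sumr -big_split; apply: eq_bigr => j _.
  by rewrite !mxE scalerDl scalerA.
pose B : {linear 'rV[R]_m -> 'rV[R]_n} :=
  HB.pack B0 (GRing.isLinear.Build _ _ _ _ B0 B0_lin).
have cB : continuous B.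
  (* Continuity is the case of order 0 of stability under sums and scaling. *)
  have CB : Ck_on 0 setT B0.
    apply: Ck_on_sum => [|j]; first exact: openT.
    apply: Ck_on_scale; [exact: openT| |exact: Ck_on_cst].
    by move=> w _; exact: coord_continuous.
  by move=> w; exact: CB.
have dsB w : 'd s x (B w) = w.
  rewrite [RHS]row_sum_delta [LHS]linear_sum; apply: eq_bigr => j _.
  by rewrite linearZ bE.
have dE : 'd (F1 - F2) x v = 'd F1 x v - 'd F2 x v :=
  congr1 (@^~ v) (diffB dF1 dF2).
apply/eqP; rewrite -subr_eq0; apply/eqP; apply: etrans (esym dE) _.
apply: (diff_vanish_on_level_set (smooth_at_strict ss) cB dsB dsv).
  exact: differentiableB.
by apply: filterS FE => y FE /FE; rewrite !fctE => ->; rewrite subrr.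
Qed.

(** * Manifolds in charts *)

Section Charts.
Variables (R : realType) (T : topologicalType) (n : nat) (c : chart R T n).

Lemma cinv_continuous y : ccod c y -> {for y, continuous (cinv c)}.
Proof.
move=> cy; have := @cinv_cont _ _ _ c.
by rewrite continuous_open_subspace; [apply; rewrite inE|exact: ccod_open].
Qed.

Lemma near_ccod p : cdom c p -> \forall y \near cmap c p, ccod c y.
Proof.
move=> cp; apply: open_nbhs_nbhs; split; first exact: ccod_open.
exact: cmap_cod.
Qed.

Lemma near_cinv p (A : set T) : cdom c p -> nbhs p A ->
  \forall y \near cmap c p, A (cinv c y).
Proof.
move=> cp pA; have := cinv_continuous (cmap_cod cp).
by apply; rewrite cmapK.
Qed.

Lemma near_cdom p : cdom c p -> nbhs p (cdom c).
Proof. by move=> cp; apply: open_nbhs_nbhs; split; first exact: cdom_open. Qed.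

Lemma cmap_inj p q : cdom c p -> cdom c q -> cmap c p = cmap c q -> p = q.
Proof. by move=> cp cq pq; rewrite -(cmapK cp) pq cmapK. Qed.
End Charts.

Section Manifolds.
Variables (R : realType).
Implicit Types (M N P : manifold R).

Lemma chart_at_atlas M (p : M) : atlas (chart_at p).
Proof. by rewrite /chart_at; case: cid => c []. Qed.

Lemma chart_at_cdom M (p : M) : cdom (chart_at p) p.
Proof. by rewrite /chart_at; case: cid => c []. Qed.

(** Continuity of f ensures that the domain of the chart expression is a
    neighbourhood of the point. *)
Lemma smooth_map_at M N (f : M -> N) c d p :
  smooth_map f -> atlas c -> atlas d -> cdom c p -> cdom d (f p) ->
  smooth_at (cmap d \o f \o cinv c) (cmap c p).
Proof.
move=> [cf sf] ac ad cp dfp; have sfcd := sf c d ac ad.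
set U := _ `&` _ in sfcd; exists U°; split; first exact: open_interior.
  apply: filterI; first exact: near_ccod.
  by apply: (@near_cinv _ _ _ c p (f @^-1` cdom d)) => //;
    apply: cf; exact: near_cdom.
by move=> k; apply: Ck_on_sub (sfcd k); exact: interior_subset.
Qed.

Lemma smooth_fun_at M (L : M -> R) c y : smooth_fun L -> atlas c -> ccod c y ->
  smooth_at (L \o cinv c : _ -> R^o) y.
Proof.
move=> sL ac cy; exists (ccod c).
by split; [exact: ccod_open|exact: cy|exact: sL].
Qed.

(** Compatibility of the atlas, read as a statement about the identity. *)
Lemma smooth_map_id M : smooth_map (@id M).
Proof.
split; first by move=> p; exact: cvg_id.
by move=> c d ac ad; exact: atlas_compat.
Qed.

Lemma smooth_map_cst M N (q : N) : smooth_map (fun _ : M => q).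
Proof.
split; first exact: cst_continuous.
by move=> c d _ _ k; exact: Ck_on_cst.
Qed.

Definition local_rep M N (f : M -> N) (p : M) :=
  cmap (chart_at (f p)) \o f \o cinv (chart_at p).

(** The hypotheses under which [tangent_map] is functorial.  Continuity is
    separate, as differentiability of the chart expression does not prevent f
    from leaving the domain of the target chart. *)
Definition differentiable_map M N (f : M -> N) (p : M) : Prop :=
  {for p, continuous f} /\ differentiable (local_rep f p) (cmap (chart_at p) p).

Lemma smooth_map_local_rep M N (f : M -> N) p : smooth_map f ->
  smooth_at (local_rep f p) (cmap (chart_at p) p).
Proof.
by move=> sf; apply: smooth_map_at;
  [|exact: chart_at_atlas|exact: chart_at_atlas
   |exact: chart_at_cdom|exact: chart_at_cdom].
Qed.

Lemma smooth_map_differentiable M N (f : M -> N) p :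
  smooth_map f -> differentiable_map f p.
Proof.
move=> sf; split; first by have [cf _] := sf; exact: cf.
exact: smooth_at_diff (smooth_map_local_rep p sf).
Qed.

Lemma local_rep_center M N (f : M -> N) p :
  local_rep f p (cmap (chart_at p) p) = cmap (chart_at (f p)) (f p).
Proof. by rewrite /local_rep /= cmapK //; exact: chart_at_cdom. Qed.

Lemma local_rep_comp M N P (f : M -> N) (g : N -> P) p :
  {for p, continuous f} -> \forall y \near cmap (chart_at p) p,
    (local_rep g (f p) \o local_rep f p) y = local_rep (g \o f) p y.
Proof.
move=> cf; have : nbhs p (f @^-1` cdom (chart_at (f p))).
  by apply: cf; apply: near_cdom; exact: chart_at_cdom.
move=> /(near_cinv (chart_at_cdom p)); apply: filterS => y dy.
by rewrite /local_rep /= cmapK.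
Qed.

Lemma differentiable_map_comp M N P (f : M -> N) (g : N -> P) p :
  differentiable_map f p -> differentiable_map g (f p) ->
  differentiable_map (g \o f) p.
Proof.
move=> [cf df] [cg dg]; split; first exact: continuous_comp.
apply: near_eq_differentiable (local_rep_comp g cf) _.
apply: differentiable_comp; first exact: df.
by rewrite local_rep_center; exact: dg.
Qed.

Lemma tangent_map_comp M N P (f : M -> N) (g : N -> P) p v :
  differentiable_map f p -> differentiable_map g (f p) ->
  tangent_map (g \o f) p v = tangent_map g (f p) (tangent_map f p v).
Proof.
move=> [cf df] [cg dg]; rewrite /tangent_map -/(local_rep _ _).
rewrite -/(local_rep f p) -/(local_rep g (f p)).
have dg' : differentiable (local_rep g (f p))
    (local_rep f p (cmap (chart_at p) p)).
  by rewrite local_rep_center.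
rewrite -(near_eq_diff v (local_rep_comp g cf)); last exact: differentiable_comp.
by rewrite (diff_comp df dg') /= local_rep_center.
Qed.

Lemma tangent_map0 M N (f : M -> N) p : tangent_map f p 0 = 0.
Proof. exact: linear0. Qed.

Lemma tangent_mapB M N (f : M -> N) p u v :
  tangent_map f p (u - v) = tangent_map f p u - tangent_map f p v.
Proof. exact: linearB. Qed.

(** The extensions among which [tangent_deriv] chooses. *)
Definition extends_at M (S : set M) (f : M -> R) (p : M)
    (F : 'rV[R]_(dim M) -> R^o) : Prop :=
  let c := chart_at p in
  is_extension_at (ccod c `&` cinv c @^-1` S) (f \o cinv c) (cmap c p) F.

Lemma extends_atP M (S : set M) (f : M -> R) (p : M) F :
  extends_at S f p F <-> smooth_at F (cmap (chart_at p) p) /\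
    \forall y \near cmap (chart_at p) p, S (cinv (chart_at p) y) ->
       F y = f (cinv (chart_at p) y).
Proof.
rewrite /extends_at; split=> [/is_extension_atP[sF FE]|[sF FE]].
  split=> //; apply: filterS2 (near_ccod (chart_at_cdom p)) FE => y cy FE Sy.
  by apply: FE.
apply/is_extension_atP; split=> //; apply: filterS FE => y FE [_ Sy]; exact: FE.
Qed.

(** The extension selected by the definition and F agree at the points of the
    level set of s through p, hence have the same differential on the kernel
    of the differential of s. *)
Lemma tangent_derivE M N (s : M -> N) (f : M -> R) p v F : submersion s ->
  tangent_map s p v = 0 -> extends_at [set q | s q = s p] f p F ->
  tangent_deriv [set q | s q = s p] f p v = 'd F (cmap (chart_at p) p) v.
Proof.
move=> [ss surj] sv FE; rewrite /tangent_deriv.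
set F0 := xget _ _.
have /extends_atP[sF0 F0E] : extends_at [set q | s q = s p] f p F0.
  exact: (@xgetPex _ _ (fun G => extends_at [set q | s q = s p] f p G)
    (ex_intro _ F FE)).
have {FE} /extends_atP[sF FE] := FE.
apply: (@diff_eq_on_level_set _ _ _ (local_rep s p)).
- exact: smooth_map_local_rep.
- exact: surj.
- exact: sv.
- exact: smooth_at_diff.
- exact: smooth_at_diff.
have /(near_cinv (chart_at_cdom p)) : nbhs p (s @^-1` cdom (chart_at (s p))).
  by apply: ss.1; apply: near_cdom; exact: chart_at_cdom.
move: FE F0E; apply: filterS3 => y FE F0E dy; rewrite local_rep_center => sE.
have Sy : s (cinv (chart_at p) y) = s p.
  by apply: (cmap_inj dy (chart_at_cdom _)).
by rewrite FE ?F0E.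
Qed.

Lemma extends_at_comp M N (Phi : M -> N) (S : set M) (S' : set N)
    (f : M -> R) (f' : N -> R) p F : smooth_map Phi ->
  (forall q, S q -> S' (Phi q)) -> (forall q, S q -> f q = f' (Phi q)) ->
  extends_at S' f' (Phi p) F -> extends_at S f p (F \o local_rep Phi p).
Proof.
move=> sPhi SS' fE /extends_atP[sF FE]; apply/extends_atP.
have sP := smooth_map_local_rep p sPhi; split.
  apply: smooth_at_comp => //; first exact: rV_has_coordinates.
  by rewrite local_rep_center.
have cP := differentiable_continuous (smooth_at_diff sP).
move: FE; rewrite -(local_rep_center Phi p) => FE.
have {}FE : \forall y \near cmap (chart_at p) p,
    S' (cinv (chart_at (Phi p)) (local_rep Phi p y)) ->
    F (local_rep Phi p y) = f' (cinv (chart_at (Phi p)) (local_rep Phi p y)).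
  exact: cP _ FE.
have /(near_cinv (chart_at_cdom p)) : nbhs p (Phi @^-1` cdom (chart_at (Phi p))).
  by apply: sPhi.1; apply: near_cdom; exact: chart_at_cdom.
move: FE; apply: filterS2 => y /= FE dy Sy; have PhiE :
    cinv (chart_at (Phi p)) (local_rep Phi p y) = Phi (cinv (chart_at p) y).
  exact: cmapK.
by rewrite FE PhiE; [rewrite fE|exact: SS'].
Qed.

(** The extension F of f' gives one of f by composition with Phi, so that both
    sides can be computed from F and related by the usual chain rule. *)
Lemma tangent_deriv_comp M M' N N' (Phi : M -> M') (s : M -> N) (s' : M' -> N')
    (f : M -> R) (f' : M' -> R) p v F : smooth_map Phi ->
  submersion s -> submersion s' ->
  (forall q, s q = s p -> s' (Phi q) = s' (Phi p)) ->
  (forall q, s q = s p -> f q = f' (Phi q)) ->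
  tangent_map s p v = 0 -> tangent_map s' (Phi p) (tangent_map Phi p v) = 0 ->
  extends_at [set q | s' q = s' (Phi p)] f' (Phi p) F ->
  tangent_deriv [set q | s q = s p] f p v =
  tangent_deriv [set q | s' q = s' (Phi p)] f' (Phi p) (tangent_map Phi p v).
Proof.
move=> sPhi ss ss' SS' fE sv s'v FE.
rewrite (tangent_derivE ss' s'v FE).
rewrite (tangent_derivE ss sv
  (extends_at_comp (S := [set q | s q = s p]) sPhi SS' fE FE)).
have dP := smooth_at_diff (smooth_map_local_rep p sPhi).
have /extends_atP[/smooth_at_diff dF _] := FE.
have dF' : differentiable F (local_rep Phi p (cmap (chart_at p) p)).
  by rewrite local_rep_center.
by rewrite (diff_comp dP dF') /= local_rep_center.
Qed.

End Manifolds.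

(** * Groupoids and morphisms *)

Section Groupoids.
Variables (R : realType).
Implicit Types (G : lie_groupoid R).

(** Covers both terms of the discrete Euler-Lagrange operator:
    k |-> L(gk) with A constant and B the identity, k |-> L(k^-1 h) with A the
    inversion and B constant. *)
Lemma mul_extension G (L : arr G -> R) (A B : arr G -> arr G)
    (S : set (arr G)) (p : arr G) :
  smooth_fun L -> smooth_map A -> smooth_map B ->
  S p -> (forall k, S k -> composable (A k) (B k)) ->
  exists F, extends_at S (fun k => L (mul (A k) (B k))) p F.
Proof.
move=> sL sA sB Sp SAB.
pose m := mul (A p) (B p).
pose cA := chart_at (A p); pose cB := chart_at (B p); pose e := chart_at m.
have sA' := smooth_map_local_rep p sA; have sB' := smooth_map_local_rep p sB.
have [mulc mul_s] := @mul_smooth _ G.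
pose z0 := (cmap cA (A p), cmap cB (B p)).
have Ap := chart_at_cdom (A p); have Bp := chart_at_cdom (B p).
have mp := chart_at_cdom m.
have aA := chart_at_atlas (A p); have aB := chart_at_atlas (B p).
have ae := chart_at_atlas m.
have [|FM] := mul_s cA cB e aA aB ae z0.
  by split; rewrite /z0 /= ?cmapK //; [exact: cmap_cod|exact: cmap_cod|exact: SAB].
move=> /is_extension_atP[sFM FME].
pose y0 := cmap (chart_at p) p.
pose AB y := (local_rep A p y, local_rep B p y).
have AB0 : AB y0 = z0 by rewrite /AB /y0 !local_rep_center.
have sAB : smooth_at AB y0 by exact: smooth_at_pair.
have FM0 : FM z0 = cmap e m.
  rewrite (nbhs_singleton FME) /= ?cmapK //.
  by split; rewrite /z0 /= ?cmapK //; [exact: cmap_cod|exact: cmap_cod|exact: SAB].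
have cprod : has_coordinates ('rV[R]_(dim (arr G)) * 'rV[R]_(dim (arr G)))%type.
  by apply: prod_has_coordinates; exact: rV_has_coordinates.
exists ((L \o cinv e) \o (FM \o AB)); apply/extends_atP; split.
  apply: smooth_at_comp; first exact: rV_has_coordinates.
    by apply: smooth_at_comp => //; rewrite AB0.
  by rewrite /= AB0 FM0; apply: smooth_fun_at => //; exact: cmap_cod.
have nearA : \forall y \near y0, cdom cA (A (cinv (chart_at p) y)).
  apply: (@near_cinv _ _ _ (chart_at p) p (A @^-1` cdom cA)).
    exact: chart_at_cdom.
  by apply: sA.1; exact: near_cdom.
have nearB : \forall y \near y0, cdom cB (B (cinv (chart_at p) y)).
  apply: (@near_cinv _ _ _ (chart_at p) p (B @^-1` cdom cB)).
    exact: chart_at_cdom.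
  by apply: sB.1; exact: near_cdom.
have nearm : \forall y \near y0, S (cinv (chart_at p) y) ->
    cdom e (mul (A (cinv (chart_at p) y)) (B (cinv (chart_at p) y))).
  apply: (@near_cinv _ _ _ (chart_at p) p
    [set k | S k -> cdom e (mul (A k) (B k))]); first exact: chart_at_cdom.
  have ABc : {for p, continuous (fun k => (A k, B k))}.
    by apply: cvg_pair; [exact: sA.1|exact: sB.1].
  (* The extension of the product is only known to agree with it where the
     product lies in the domain of e; this holds near p by continuity of the
     product on composable pairs. *)
  have /subspace_continuousP/(_ (A p, B p) (SAB p Sp)) mulW := mulc.
  have {}mulW : \forall z \near (A p, B p),
      tgt z.1 = src z.2 -> cdom e (mul z.1 z.2).
    exact: mulW (cdom e) (near_cdom mp).
  have {}mulW : \forall k \near p, tgt (A k) = src (B k) ->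
      cdom e (mul (A k) (B k)).
    exact: ABc _ mulW.
  by apply: filterS mulW => k kW Sk; apply: kW; exact: SAB.
have ABc0 := differentiable_continuous (smooth_at_diff sAB).
rewrite -AB0 in FME; have {}FME := ABc0 _ FME.
have nearc := near_ccod (chart_at_cdom p).
near=> y => Sk.
have dA : cdom cA (A (cinv (chart_at p) y)) by near: y.
have dB : cdom cB (B (cinv (chart_at p) y)) by near: y.
have dm : cdom e (mul (A (cinv (chart_at p) y)) (B (cinv (chart_at p) y))).
  by move: Sk; near: y.
have kA : cinv cA (local_rep A p y) = A (cinv (chart_at p) y) by exact: cmapK.
have kB : cinv cB (local_rep B p y) = B (cinv (chart_at p) y) by exact: cmapK.
have FMy : FM (AB y) =
    cmap e (mul (A (cinv (chart_at p) y)) (B (cinv (chart_at p) y))).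
  have -> : FM (AB y) = cmap e (mul (cinv cA (AB y).1) (cinv cB (AB y).2)).
    have D : [/\ ccod cA (AB y).1, ccod cB (AB y).2,
        tgt (cinv cA (AB y).1) = src (cinv cB (AB y).2) &
        cdom e (mul (cinv cA (AB y).1) (cinv cB (AB y).2))].
      rewrite /AB /= kA kB.
      by split; [exact: cmap_cod|exact: cmap_cod|exact: SAB|].
    by move: D; near: y.
  by rewrite /AB /= kA kB.
by rewrite /= FMy cmapK.
Unshelve. all: by end_near. Qed.

(** The image of a unit is idempotent, and an idempotent of a groupoid is a
    unit. *)
Lemma morph_idn G G' (Phi : arr G -> arr G') Phi0 x :
  lie_groupoid_morphism Phi Phi0 -> Phi (idn x) = idn (Phi0 x).
Proof.
move=> [_ PhiC PhiM Phi0E]; set e := Phi (idn x).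
have cx : composable (idn x) (idn x) by rewrite /composable tgt_idn src_idn.
have ee : mul e e = e.
  by rewrite /e -PhiM // -{1}(src_idn x) mul_idl.
have ce : tgt e = src e by exact: PhiC cx.
have -> : idn (Phi0 x) = mul (inv e) (mul e e).
  by rewrite ee mul_invl ce Phi0E.
by rewrite -mulA ?tgt_inv // mul_invl ce mul_idl.
Qed.

(** The projection of arrows to units: the tangent space at a unit is the direct
    sum of the image of its differential and the algebroid. *)
Definition src_unit G (k : arr G) : arr G := idn (src k).

Lemma src_differentiable G (k : arr G) : differentiable_map (@src R G) k.
Proof. by apply: smooth_map_differentiable; have [] := src_submersion G. Qed.

Lemma idn_differentiable G (x : base G) : differentiable_map (@idn R G) x.
Proof. by apply: smooth_map_differentiable; exact: idn_smooth. Qed.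

Lemma src_unit_differentiable G (k : arr G) :
  differentiable_map (@src_unit G) k.
Proof.
by apply: differentiable_map_comp;
  [exact: src_differentiable|exact: idn_differentiable].
Qed.

Lemma tangent_src_unit G (k : arr G) v : tangent_map (@src_unit G) k v =
  tangent_map (@idn R G) (src k) (tangent_map (@src R G) k v).
Proof.
by apply: (@tangent_map_comp _ _ _ _ (@src R G) (@idn R G));
  [exact: src_differentiable|exact: idn_differentiable].
Qed.

Section Morphism.
Variables (G G' : lie_groupoid R) (Phi : arr G -> arr G').
Variables (Phi0 : base G -> base G') (HPhi : lie_groupoid_morphism Phi Phi0).

Lemma morph_src k : src (Phi k) = Phi0 (src k).
Proof.
have [_ PhiC _ _] := HPhi.
have /PhiC : composable (idn (src k)) k by rewrite /composable tgt_idn.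
by rewrite /composable (morph_idn _ HPhi) tgt_idn.
Qed.

Lemma morph_tgt k : tgt (Phi k) = Phi0 (tgt k).
Proof.
have [_ PhiC _ _] := HPhi.
have /PhiC : composable k (idn (tgt k)) by rewrite /composable src_idn.
by rewrite /composable (morph_idn _ HPhi) src_idn.
Qed.

Lemma morph_inv k : Phi (inv k) = inv (Phi k).
Proof.
have [_ _ PhiM _] := HPhi.
have ck : composable k (inv k) by rewrite /composable src_inv.
have tgtV : tgt (inv (Phi k)) = src (Phi k) by rewrite tgt_inv.
have tgtP : tgt (Phi k) = src (Phi (inv k)).
  by rewrite morph_tgt morph_src src_inv.
have : mul (inv (Phi k)) (mul (Phi k) (Phi (inv k))) = inv (Phi k).
  rewrite -PhiM // mul_invr (morph_idn _ HPhi) -morph_src -tgtV; exact: mul_idr.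
by rewrite -mulA // mul_invl tgtP mul_idl.
Qed.

Let dPhi k : differentiable_map Phi k.
Proof. by have [sPhi _ _ _] := HPhi; exact: smooth_map_differentiable. Qed.

(** src o Phi factors through idn o src, whose differential at a unit kills the
    algebroid. *)
Lemma morph_algebroid x v : algebroid x v ->
  algebroid (Phi0 x) (tangent_map Phi (idn x) v).
Proof.
move=> sv; rewrite /algebroid /= -(morph_idn _ HPhi).
rewrite -tangent_map_comp; [|exact: dPhi|exact: src_differentiable].
have -> : @src R G' \o Phi = (@src R G' \o Phi) \o @src_unit G.
  by apply/funext => k; rewrite /= !morph_src /src_unit src_idn.
have dsP : differentiable_map (@src R G' \o Phi) (src_unit (idn x)).
  by apply: differentiable_map_comp; [exact: dPhi|exact: src_differentiable].
rewrite tangent_map_comp; [|exact: src_unit_differentiable|exact: dsP].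
by rewrite tangent_src_unit sv !tangent_map0.
Qed.

(** Lift w to a vector u and subtract the unit part of u.  T Phi maps the unit
    part of u to that of w, since Phi commutes with the projections to units,
    and the unit part of w vanishes. *)
Lemma submersion_algebroid_surj x w : submersion Phi ->
  algebroid (Phi0 x) w ->
  exists2 v, algebroid x v & tangent_map Phi (idn x) v = w.
Proof.
move=> [sPhi surj] sw; have [u uw] := surj (idn x) w.
have unitx : src_unit (idn x) = idn x by rewrite /src_unit src_idn.
exists (u - tangent_map (@src_unit G) (idn x) u).
  apply: etrans (tangent_mapB _ _ _ _) _.
  have := tangent_map_comp u (src_unit_differentiable (idn x))
    (src_differentiable (src_unit (idn x))).
  rewrite unitx => <-.
  have -> : @src R G \o @src_unit G = @src R G.
    by apply/funext => k; rewrite /src_unit /= src_idn.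
  exact: subrr.
rewrite tangent_mapB uw.
have := tangent_map_comp u (src_unit_differentiable (idn x))
  (dPhi (src_unit (idn x))).
rewrite unitx => <-.
have -> : Phi \o @src_unit G = @src_unit G' \o Phi.
  by apply/funext => k; rewrite /src_unit /= (morph_idn _ HPhi) morph_src.
rewrite tangent_map_comp; [|exact: dPhi|exact: src_unit_differentiable].
by rewrite uw (morph_idn _ HPhi) tangent_src_unit sw tangent_map0 subr0.
Qed.

(** The two functions differentiated are related by Phi on the source fibre, so
    this is [tangent_deriv_comp] for the source maps. *)
Lemma Ddel_morph (L' : arr G' -> R) g h v : smooth_fun L' -> composable g h ->
  algebroid (tgt g) v ->
  Ddel (L' \o Phi) g h v =
  Ddel L' (Phi g) (Phi h) (tangent_map Phi (idn (tgt g)) v).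
Proof.
move=> sL' gh Av; have [sPhi PhiC PhiM _] := HPhi.
set x := tgt g; set w := tangent_map Phi (idn x) v.
have Aw : algebroid (Phi0 x) w by exact: morph_algebroid.
pose f' k := (L' \o ltrans (Phi g)) k + (L' \o rtrans (Phi h) \o @inv R G') k.
have idnE : Phi (idn x) = idn (Phi0 x) by exact: (morph_idn _ HPhi).
have [F FE] : exists F,
    extends_at [set k | src k = src (Phi (idn x))] f' (Phi (idn x)) F.
  have src_x : src (Phi (idn x)) = tgt (Phi g).
    by rewrite morph_src src_idn morph_tgt.
  have [||||F1 F1E] := @mul_extension G' L' (fun=> Phi g) id
    [set k | src k = src (Phi (idn x))] (Phi (idn x)) sL'.
  - exact: smooth_map_cst.
  - exact: smooth_map_id.
  - by [].
  - by move=> k; rewrite /composable /= => ->.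
  have [||||F2 F2E] := @mul_extension G' L' (@inv R G') (fun=> Phi h)
    [set k | src k = src (Phi (idn x))] (Phi (idn x)) sL'.
  - exact: inv_smooth.
  - exact: smooth_map_cst.
  - by [].
  - by move=> k; rewrite /composable /= tgt_inv => ->; rewrite src_x; exact: PhiC.
  have /extends_atP[sF1 F1P] := F1E; have /extends_atP[sF2 F2P] := F2E.
  exists (F1 + F2); apply/extends_atP; split; first exact: smooth_at_add.
  by move: F1P F2P; apply: filterS2 => y F1P F2P Sy; rewrite fctE F1P ?F2P.
have := @tangent_deriv_comp R _ _ _ _ Phi (@src R G) (@src R G')
  (fun k => ((L' \o Phi) \o ltrans g) k +
            ((L' \o Phi) \o rtrans h \o @inv R G) k)
  f' (idn x) v F sPhi (src_submersion G) (src_submersion G').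
rewrite src_idn /Ddel morph_tgt -/x.
have src_x : src (Phi (idn x)) = Phi0 x by rewrite morph_src src_idn.
rewrite src_x -/f' -idnE; apply.
- by move=> q; rewrite morph_src => ->.
- move=> q sq; rewrite /f' /ltrans /rtrans /= -morph_inv // -!PhiM //.
    by rewrite /composable tgt_inv sq.
- exact: Av.
- by rewrite -/w idnE; exact: Aw.
- by rewrite -src_x.
Qed.

End Morphism.
End Groupoids.

Theorem corollary4p7 (R : realType) (G G' : lie_groupoid R)
    (Phi : arr G -> arr G') (Phi0 : base G -> base G')
    (L : arr G -> R) (L' : arr G' -> R) (g h : arr G)
    (HPhi : lie_groupoid_morphism Phi Phi0)
    (HL : smooth_fun L) (HL' : smooth_fun L')
    (HLL' : L = (L' \o Phi)%FUN)
    (Hgh : composable g h) :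
  [/\ del_solution L' (Phi g) (Phi h) -> del_solution L g h,
      submersion Phi ->
        (del_solution L g h <-> del_solution L' (Phi g) (Phi h)) &
      immersion Phi ->
        (del_solution L g h <->
         forall w, im_algebroid Phi (tgt g) w -> Ddel L' (Phi g) (Phi h) w = 0%R)].
Proof.
have PhiC : composable (Phi g) (Phi h).
  by have [_ PhiC _ _] := HPhi; exact: PhiC.
have DE v : algebroid (tgt g) v -> Ddel L g h v =
    Ddel L' (Phi g) (Phi h) (tangent_map Phi (idn (tgt g)) v).
  by move=> Av; rewrite HLL'; exact: (Ddel_morph HPhi HL' Hgh Av).
have pullback : del_solution L' (Phi g) (Phi h) -> del_solution L g h.
  move=> [_ D0]; split=> // v Av; rewrite DE //; apply: D0.
  by rewrite (morph_tgt HPhi); exact: morph_algebroid.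
split=> [//|subPhi|_].
  split=> [[_ D0]|//]; split=> // w; rewrite (morph_tgt HPhi).
  move=> /(submersion_algebroid_surj HPhi subPhi)[v Av <-].
  by rewrite -DE //; exact: D0.
split=> [[_ D0] _ [v Av <-]|D0]; first by rewrite -DE //; exact: D0.
by split=> // v Av; rewrite DE //; apply: D0; exists v.
Qed.
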